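(* Let $0\le L<U<\infty$, $\beta_1\ge 0$, $\beta_2>0$, $\beta_3>0$, let $n_1,n_2,n_3$ be positive integers, and write $\mu(x)=\beta_1+\beta_2x^{\beta_3}$ and $\mu_i=\mu(x_i)$. Let $g$ be a canonical link function as described in the context, and for stimuli $L\le x_1<x_2<x_3\le U$ let $$|I_{3\times3}(\boldsymbol\beta)|=\beta_2^2\left[(x_1x_2)^{\beta_3}\log\left(\tfrac{x_2}{x_1}\right)-(x_1x_3)^{\beta_3}\log\left(\tfrac{x_3}{x_1}\right)+(x_2x_3)^{\beta_3}\log\left(\tfrac{x_3}{x_2}\right)\right]^2\prod_{i=1}^3\left[n_i\,g'(\mu_i)\right].$$ Suppose that $g'(\mu)\ge 0$ and $g''(\mu)\le 0$ for all attainable means $\mu\in\{\mu(x):x\in[L,U]\}$, and let $x_1,x_3$ be given stimuli with $L\le x_1<x_3\le U$. Then the optimal stimulus $x_2^{\mathrm{opt}}$ for $x_2$ that maximizes $|I_{3\times3}(\boldsymbol\beta)|$ is obtained by solving an equation; that is, a maximizer $x_2^{\mathrm{opt}}$ of $|I_{3\times3}(\boldsymbol\beta)|$ over $x_2\in(x_1,x_3)$ exists, and any such maximizer is a solution $x_2$ of $$\beta_2\beta_3\,g''(\mu_2)\left[(x_1x_2)^{\beta_3}\log\left(\tfrac{x_2}{x_1}\right)-(x_1x_3)^{\beta_3}\log\left(\tfrac{x_3}{x_1}\right)+(x_2x_3)^{\beta_3}\log\left(\tfrac{x_3}{x_2}\right)\right]+2g'(\mu_2)\left[\beta_3x_1^{\beta_3}\log\left(\tfrac{x_2}{x_1}\right)+\beta_3x_3^{\beta_3}\log\left(\tfrac{x_3}{x_2}\right)+x_1^{\beta_3}-x_3^{\beta_3}\right]=0.$$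 The optimal solution $x_2^{\mathrm{opt}}$ lies in the interval $(x_1,x_3)$ and satisfies $$\beta_3\log(x_2^{\mathrm{opt}})\le\frac{x_3^{\beta_3}\log(x_3^{\beta_3})-x_1^{\beta_3}\log(x_1^{\beta_3})-(x_3^{\beta_3}-x_1^{\beta_3})}{x_3^{\beta_3}-x_1^{\beta_3}}.$$
   Context: Setting: independent responses $y_{ij}$, $j=1,\dots,n_i$, at stimulus $x_i\ge 0$, $i=1,2,3$, have density $\exp\{[y\theta_i-b(\theta_i)]/a(\phi)+c(y,\phi)\}$ with $b$ at least twice differentiable, so that $\mathbb{E}(y_{ij}|x_i)=\mu_i=b'(\theta_i)$ and $\mathrm{Var}(y_{ij}|x_i)=b''(\theta_i)a(\phi)$. The mean is the Mitscherlich function $\mu_i=\beta_1+\beta_2x_i^{\beta_3}$, with $\boldsymbol\beta=(\beta_1,\beta_2,\beta_3)^T$. The canonical link $g$ satisfies $\theta_i=g(\mu_i)$, i.e. $g$ is the inverse of $b'$ (hence $g'(\mu)\,b''(g(\mu))=1$). It is a twice differentiable real function on an open interval containing all attainable means $\mu(x)=\beta_1+\beta_2x^{\beta_3}$, $x\in[L,U]$. $I_{3\times3}(\boldsymbol\beta)$ is the $3\times 3$ matrix with entries $\sum_{i=1}^3 n_i g'(\mu_i)\frac{\partial\mu_i}{\partial\beta_r}\frac{\partial\mu_i}{\partial\beta_s}$ (the Fisher information for $\boldsymbol\beta$ up to the factor $1/a(\phi)$); its determinant is the expression displayed in the claim. Convention: when $x_1=0$, terms of the form $x_1^{\beta_3}\log(c/x_1)$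 with $c>0$, and $x_1^{\beta_3}\log(x_1^{\beta_3})$, are read as their limit $0$. *)

(* Defs.v *)
From HB Require Import structures.
From mathcomp Require Import all_boot all_order all_algebra.
From mathcomp Require Import all_classical all_reals all_analysis.

Set Implicit Arguments.
Unset Strict Implicit.
Unset Printing Implicit Defensive.

Import Order.TTheory GRing.Theory Num.Theory.
Import numFieldNormedType.Exports.

Local Open Scope classical_set_scope.
Local Open Scope ring_scope.

Definition triple (T : Type) (a b c : T) (i : 'I_3) : T := nth c [:: a; b] i.

(* [ln x = 0] for [x <= 0], [x^-1 = 0] for [x = 0] and [0 `^ p = 0] for
   [p != 0]: every product [x `^ p * ln (c / x)] or [x `^ p * ln (x `^ p)] with
   [p > 0] is therefore [0], its limit, at [x = 0]. *)
Definition mitscherlich (R : realType) (beta : 'cV[R]_3) (x : R) : R :=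
  beta 0 0 + beta 1 0 * x `^ beta 2%:R 0.

Definition params (R : realType) (beta1 beta2 beta3 : R) : 'cV[R]_3 :=
  \col_r triple beta1 beta2 beta3 r.

Definition mean_partial (R : realType) (r : 'I_3) (beta : 'cV[R]_3) (x : R) : R :=
  'D_(delta_mx r 0) (fun be : 'cV[R]_3 => mitscherlich be x) beta.

(* The Fisher information for [beta], up to the factor 1 / a(phi): for the
   canonical link the weight 1 / b''(g mu) equals g' mu. *)
Definition fisher_info (R : realType) (g : R -> R) (n : 'I_3 -> nat)
    (beta : 'cV[R]_3) (x : 'I_3 -> R) : 'M[R]_3 :=
  \matrix_(r < 3, s < 3) \sum_(i < 3)
    (n i)%:R * derive1 g (mitscherlich beta (x i))
    * mean_partial r beta (x i) * mean_partial s beta (x i).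

Definition twice_derivable_on (R : realType) (A : set R) (f : R -> R) : Prop :=
  forall t, A t -> derivable f t 1 /\ derivable (derive1 f) t 1.

(* [b] is the cumulant function of the density
   exp ((y * theta - b theta) / a(phi) + c(y, phi)), [Theta] its open interval of
   natural parameters and [J] an open interval of means on which [g], the inverse
   of [b'], is twice differentiable.  [Theta] need not be the whole line
   (e.g. gamma responses). *)
Definition canonical_link (R : realType) (b : R -> R) (Theta : set R)
    (g : R -> R) (J : set R) : Prop :=
  [/\ [/\ open Theta, is_interval Theta & twice_derivable_on Theta b],
      [/\ open J, is_interval J & twice_derivable_on J g],
      (forall theta, Theta theta -> g (derive1 b theta) = theta)
    & (forall m, J m -> Theta (g m) /\ derive1 b (g m) = m)].

Definition contrast (R : realType) (p x1 x2 x3 : R) : R :=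
  (x1 * x2) `^ p * ln (x2 / x1) - (x1 * x3) `^ p * ln (x3 / x1)
  + (x2 * x3) `^ p * ln (x3 / x2).

Definition maximizer_on (R : realType) (A : set R) (f : R -> R) (x : R) : Prop :=
  A x /\ forall y, A y -> f y <= f x.

(* Main.v *)
Require Import Defs.
From HB Require Import structures.
From mathcomp Require Import all_boot all_order all_algebra.
From mathcomp Require Import all_classical all_reals all_analysis.
From mathcomp Require Import ring.

Import Order.TTheory GRing.Theory Num.Theory.
Import numFieldNormedType.Exports.

Local Open Scope classical_set_scope.
Local Open Scope ring_scope.

(** The mean has gradient (1, x^p, beta2 x^p ln x) in beta, where p = beta3, so
    the information matrix is a weighted Gram matrix V^T W V whose row i of V is
    the gradient at x_i. Its determinant is (det V)^2 times the product of the
    weights, and det V is beta2 times the contrast C. This gives the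
    displayed determinant ([det_fisher_info]).

    As a function of x2 the determinant is therefore K F(x2), with
    F = C^2 (g' o mu) and K constant. Differentiating m = b'(g m) shows that g'
    never vanishes on J ([canonical_link_derive_neq0]); being nonnegative at the
    attainable means, it is positive there, and K > 0.

    Existence. F is continuous on [x1, x3], nonnegative, and zero at both ends,
    because two rows of V coincide there. So a maximum over the closed interval
    is attained in the open one, or else F is identically zero. When x1 = 0 the
    continuity at x1 amounts to x^p ln x -> 0.

    First-order condition. The derivative of F at x2 is x2^(p-1) C times the
    left-hand side of the stated equation ([is_derive_information_profile]), and
    C > 0 for x1 < x2 < x3 ([contrast_gt0]) by strict convexity of the
    exponential. So the equation holds at any maximizer.

    Bound. In that equation g'' <= 0 < C and g' > 0, hence the bracket
    multiplying 2 g' is nonnegative; this bracket is affine in ln x2, and solving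
    for p ln x2 is the claimed inequality ([contrast_slopeE]). *)

(** * The contrast as an alternating form *)

Definition powR_ln {R : realType} (p x : R) : R := x `^ p * ln x.

(** The determinant of the matrix with rows (1, x_i^p, x_i^p ln x_i). Unlike
    [contrast] it contains no quotient, so it vanishes visibly when two points
    coincide, and x2 enters it only through two functions that, for p > 0, are
    continuous on [0, +oo[. *)
Definition contrast_form {R : realType} (p x1 x2 x3 : R) : R :=
  x1 `^ p * (powR_ln p x2 - powR_ln p x3)
  + x2 `^ p * (powR_ln p x3 - powR_ln p x1)
  + x3 `^ p * (powR_ln p x1 - powR_ln p x2).

Lemma contrast_formE {R : realType} (p x1 x2 x3 : R) :
  0 < p -> 0 <= x1 -> 0 < x2 -> 0 < x3 ->
  contrast p x1 x2 x3 = contrast_form p x1 x2 x3.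
Proof.
move=> p0 x1ge x2gt x3gt.
rewrite /contrast /contrast_form /powR_ln !powRM ?(ltW x2gt) ?(ltW x3gt)//.
rewrite (ln_div x3gt x2gt).
have [->|x1N] := eqVneq x1 0; first by rewrite powR0 ?gt_eqF//; ring.
have x1gt : 0 < x1 by rewrite lt_neqAle eq_sym x1N.
by rewrite !ln_div ?posrE//; ring.
Qed.

(** For x1 > 0, dividing by (x1 x2 x3)^p turns positivity into the strict
    convexity of t |-> exp (- t) at p ln x1 < p ln x2 < p ln x3. It follows
    from the tangent line at the middle point, that is from 1 + t < exp t used
    once on each side. *)
Lemma contrast_gt0 {R : realType} (p x1 x2 x3 : R) :
  0 < p -> 0 <= x1 -> x1 < x2 -> x2 < x3 -> 0 < contrast p x1 x2 x3.
Proof.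
move=> p0 x1ge x12 x23.
have x2gt := le_lt_trans x1ge x12; have x3gt := lt_trans x2gt x23.
have l23 : ln x2 < ln x3 by rewrite ltr_ln ?posrE.
rewrite contrast_formE// /contrast_form /powR_ln.
have u0 := powR_gt0 p x2gt; have c0 := powR_gt0 p x3gt.
have [->|x1N] := eqVneq x1 0.
  rewrite powR0 ?gt_eqF//.
  rewrite [ltRHS](_ : _ = x2 `^ p * x3 `^ p * (ln x3 - ln x2)); last by ring.
  by rewrite !mulr_gt0// subr_gt0.
have x1gt : 0 < x1 by rewrite lt_neqAle eq_sym x1N.
have l12 : ln x1 < ln x2 by rewrite ltr_ln ?posrE.
have a0 := powR_gt0 p x1gt.
(* The tangent inequality, multiplied by [y `^ p * z `^ p]: at [t = p * ln y]
   the line touching [expR (- t)] is evaluated at [t = p * ln z]. *)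
have quot (y z : R) : 0 < y -> 0 < z -> y != z ->
    z `^ p * (1 + p * (ln y - ln z)) < y `^ p.
  move=> y0 z0 yz; rewrite -ltr_pdivlMl ?powR_gt0// [ltRHS]mulrC.
  rewrite /powR !gt_eqF// -expRN -expRD -mulrN -mulrDr expR_gt1Dx//.
  apply: mulf_neq0; first by rewrite gt_eqF.
  rewrite subr_eq0; apply: contra yz => /eqP.
  by move=> /ln_inj ->; rewrite ?posrE.
have q23 := quot _ _ x2gt x3gt (negbT (lt_eqF x23)).
have q21 := quot _ _ x2gt x1gt (negbT (gt_eqF x12)).
move: (ln x1) (ln x2) (ln x3) (x1 `^ p) (x2 `^ p) (x3 `^ p) l12 l23 a0 u0 c0
  q23 q21 => l1 l2 l3 a u c l12 l23 a0 u0 c0 q23 q21.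
have h1 : 0 < a * (l2 - l1) * (u - c * (1 + p * (l2 - l3))).
  by rewrite !mulr_gt0 ?subr_gt0.
have h2 : 0 < c * (l3 - l2) * (u - a * (1 + p * (l2 - l1))).
  by rewrite !mulr_gt0 ?subr_gt0.
(* The weights in [h1] and [h2] are such that the terms with [p] cancel and the
   others make up the contrast. *)
have -> : a * (u * l2 - c * l3) + u * (c * l3 - a * l1)
    + c * (a * l1 - u * l2) =
    a * (l2 - l1) * (u - c * (1 + p * (l2 - l3))) +
    c * (l3 - l2) * (u - a * (1 + p * (l2 - l1))) by ring.
exact: addr_gt0.
Qed.

(** * Partial derivatives of the mean *)

Lemma derive_line {R : realType} (V W : normedModType R) (f : V -> W)
    (a v : V) :
  'D_v f a = derive1 (fun h : R => f (a + h *: v)) 0.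
Proof.
have E : (fun h : R => h^-1 *: ((f \o shift a) (h *: v) - f a)) =
    (fun h => h^-1 *: (f (a + (h + 0) *: v) - f (a + 0 *: v))).
  by apply/funext => h /=; rewrite addr0 scale0r addr0 [a + _]addrC.
by rewrite /derive /derive1 E.
Qed.

(** Also true at x = 0, where both sides are 0: this needs p > 0, because the
    function q |-> 0 `^ q jumps at q = 0. *)
Lemma is_derive_powR_exponent {R : realType} (p x : R) :
  0 < p -> is_derive p 1 (powR x) (powR_ln p x).
Proof.
move=> p0; have [->|xN0] := eqVneq x 0.
  have near0 : \near p, cst (0 : R) p = powR 0 p.
    near=> q; rewrite powR0// gt_eqF//; near: q; exact: lt_nbhsr.
  rewrite /powR_ln powR0 ?gt_eqF// mul0r; split.
    exact: (near_eq_derivable near0).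
  by rewrite -(near_eq_derive _ near0) derive_val.
have -> : powR x = expR \o (fun q => q * ln x).
  by apply/funext => q; rewrite /= /powR (negbTE xN0).
rewrite /powR_ln /powR (negbTE xN0); apply: is_derive1_comp.
by apply: is_derive_eq; rewrite scaler0 add0r /GRing.scale /= mulr1.
Unshelve. all: by end_near. Qed.

Lemma mean_partialE {R : realType} (beta1 beta2 beta3 x : R) (r : 'I_3) :
  0 < beta3 ->
  mean_partial r (params beta1 beta2 beta3) x =
  triple 1 (x `^ beta3) (beta2 * powR_ln beta3 x) r.
Proof.
move=> b3; rewrite /mean_partial derive_line derive1E.
(* Along coordinate [r] the three parameters move at speeds [d 0], [d 1], [d 2],
   so one differentiation serves all three cases. *)
pose d i : R := ((i == r) && (0 == 0 :> 'I_1))%:R.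
rewrite (_ : (fun h => _) = (fun h => (beta1 + h * d 0) +
   (beta2 + h * d 1) * x `^ (beta3 + h * d 2%:R))); last first.
  by apply/funext => h; rewrite /mitscherlich /params !mxE.
have D : is_derive (0 : R) 1 (fun h => (beta1 + h * d 0) +
   (beta2 + h * d 1) * x `^ (beta3 + h * d 2%:R))
  (d 0 + (d 1 * x `^ beta3 + beta2 * (powR_ln beta3 x * d 2%:R))).
  have aff (c e : R) : is_derive (0 : R) 1 (fun h => c + h * e) e.
    by apply: is_derive_eq; rewrite /GRing.scale /=; ring.
  have P : is_derive (0 : R) 1 (powR x \o (fun h => beta3 + h * d 2%:R))
      (powR_ln beta3 x * d 2%:R).
    apply: is_derive1_comp; rewrite mul0r addr0.
    exact: is_derive_powR_exponent.
  have Q := is_deriveM (aff beta2 (d 1)) P.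
  have S := is_deriveD (aff beta1 (d 0)) Q.
  apply: (is_derive_eq S).
  by rewrite /= !mul0r !addr0 /GRing.scale /=; ring.
rewrite (@derive_val _ _ _ _ _ _ _ D) /d /triple.
by case: r {d D} => [[|[|[|//]]] rlt] /=;
  rewrite ?(mulr0,mul0r,mulr1,mul1r,addr0,add0r).
Qed.

(** * Limits and derivatives in the stimulus *)

(** Half of the power tames the logarithm: ln y < y at y = x^(-p/2) gives
    -(2/p) x^(p/2) < x^p ln x <= 0 on ]0, 1[. *)
Lemma powR_ln_cvg0 {R : realType} (p : R) :
  0 < p -> powR_ln p x @[x --> 0^'+] --> 0.
Proof.
move=> p0; have p2 : 0 < p / 2 by rewrite divr_gt0.
have bound : (- (2 / p) * x `^ (p / 2)) @[x --> 0^'+] --> (0 : R).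
  rewrite -[X in _ --> X](mulr0 (- (2 / p))).
  by apply: cvgM; [exact: cvg_cst|exact: powR_cvg0].
apply: (squeeze_cvgr _ bound (cvg_cst _)).
near=> x; have x0 : 0 < x by near: x; exact: nbhs_right_gt.
have x1 : x < 1 by near: x; exact: nbhs_right_lt.
have q0 := powR_gt0 (p / 2) x0.
rewrite /powR_ln pmulr_rle0 ?powR_gt0//; apply/andP; split; last first.
  by apply: ln_le0; exact: ltW.
have lnx : - (p / 2) * ln x < (x `^ (p / 2))^-1.
  by rewrite -powRN -ln_powR; apply: ln_sublinear; exact: powR_gt0.
have -> : x `^ p = x `^ (p / 2) * x `^ (p / 2).
  by rewrite -powRD; [congr (_ `^ _); field|rewrite (gt_eqF x0) implybT].
move: lnx; rewrite -(ltr_pM2l q0) divff ?gt_eqF// => lnx.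
rewrite -subr_ge0 (_ : _ - _ = 2 / p * x `^ (p / 2) *
  (1 - x `^ (p / 2) * (- (p / 2) * ln x))); last by field; rewrite gt_eqF.
apply: mulr_ge0; last by rewrite subr_ge0 ltW.
by apply: mulr_ge0; [apply: divr_ge0 => //; exact: ltW|exact: ltW].
Unshelve. all: by end_near. Qed.

Lemma derivable_cvg_right {R : realType} (f : R -> R) (a : R) :
  derivable f a 1 -> f x @[x --> a^'+] --> f a.
Proof.
move=> /derivable1_diffP/differentiable_continuous.
exact: cvg_at_right_filter.
Qed.

Lemma powR_cvg_right {R : realType} (p a : R) :
  0 < p -> 0 <= a -> x `^ p @[x --> a^'+] --> a `^ p.
Proof.
move=> p0; rewrite le_eqVlt => /predU1P[<-|a0].
  by rewrite powR0 ?gt_eqF//; exact: powR_cvg0.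
have [dp _] := is_derive1_powR p a0.
exact: (derivable_cvg_right (fun x : R => x `^ p) a dp).
Qed.

Lemma is_derive_powR_ln {R : realType} (p x : R) :
  0 < x -> is_derive x 1 (powR_ln p) (x `^ (p - 1) * (p * ln x + 1)).
Proof.
move=> x0; have dM := is_deriveM (is_derive1_powR p x0) (is_derive1_ln x0).
apply: (is_derive_eq dM).
rewrite /GRing.scale /= powRB ?(gt_eqF x0) ?implybT// powRr1 ?ltW//.
by field; rewrite gt_eqF.
Qed.

Lemma powR_ln_cvg_right {R : realType} (p a : R) :
  0 < p -> 0 <= a -> powR_ln p x @[x --> a^'+] --> powR_ln p a.
Proof.
move=> p0; rewrite le_eqVlt => /predU1P[<-|a0].
  by rewrite {2}/powR_ln powR0 ?gt_eqF// mul0r; exact: powR_ln_cvg0.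
by apply: derivable_cvg_right; have [] := is_derive_powR_ln p a a0.
Qed.

(** * Positivity of the weights *)

(** The chain rule applied to b' (g m) = m, valid near each point of the open set
    J, gives b'' (g m) * g' m = 1. *)
Lemma canonical_link_derive_neq0 {R : realType} (b g : R -> R)
    (Theta J : set R) (m : R) :
  canonical_link b Theta g J -> J m -> derive1 g m != 0.
Proof.
move=> [[oT iT dT] [oJ iJ dJ] gb bg] Jm.
have [Tgm bgm] := bg _ Jm.
have [_ db] := dT _ Tgm; have [dg _] := dJ _ Jm.
have near_id : \near m, id m = (derive1 b \o g) m.
  near=> t; have Jt : J t by near: t; exact: open_nbhs_nbhs.
  by have [_] := bg _ Jt.
have : 'D_1 (derive1 b \o g) m = 1.
  by rewrite -(near_eq_derive _ near_id) derive_val.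
have C := is_derive1_comp (derivableP db) (derivableP dg).
rewrite (@derive_val _ _ _ _ _ _ _ C) -!derive1E => /eqP.
apply: contraTneq => ->.
by rewrite mulr0 eq_sym oner_eq0.
Unshelve. all: by end_near. Qed.

(** * The determinant of the information matrix *)

(** The matrix on the left is V^T diag(w) V. *)
Lemma det_gram_weighted {R : comRingType} (k : nat) (w : 'I_k -> R)
    (V : 'M[R]_k) :
  \det (\matrix_(r, s) \sum_i w i * V i r * V i s) = \det V ^+ 2 * \prod_i w i.
Proof.
have -> : \matrix_(r, s) (\sum_i w i * V i r * V i s) =
    V^T *m (diag_mx (\row_i w i) *m V).
  apply/matrixP => r s; rewrite !mxE; apply: eq_bigr => i _.
  by rewrite mul_diag_mx !mxE mulrCA mulrA.
rewrite !det_mulmx det_tr det_diag expr2.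
under [X in _ * (X * _)]eq_bigr => i _ do rewrite mxE.
by rewrite mulrA mulrAC.
Qed.

Lemma det_rows_1ab {R : comRingType} (a b : 'I_3 -> R) :
  \det (\matrix_(i < 3, r < 3) triple 1 (a i) (b i) r) =
  a 0 * (b 1 - b 2%:R) + a 1 * (b 2%:R - b 0) + a 2%:R * (b 0 - b 1).
Proof.
rewrite (expand_det_row _ 0) !big_ord_recl big_ord0 /cofactor.
rewrite !(expand_det_row _ 0) !big_ord_recl !big_ord0 /cofactor !det_mx11.
rewrite !mxE /triple /=.
have -> : lift 0 (lift 0 0) = 2%:R :> 'I_3 by apply/val_inj.
have -> : lift 0 0 = 1 :> 'I_3 by apply/val_inj.
by rewrite /bump /=; ring.
Qed.

Lemma det_fisher_info {R : realType} (g : R -> R) (n : 'I_3 -> nat)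
    (beta1 beta2 beta3 x1 x2 x3 : R) (beta := params beta1 beta2 beta3) :
  0 < beta3 -> 0 <= x1 -> 0 < x2 -> 0 < x3 ->
  \det (fisher_info g n beta (triple x1 x2 x3)) =
  beta2 ^+ 2 * contrast beta3 x1 x2 x3 ^+ 2
  * \prod_(i < 3) ((n i)%:R * derive1 g (mitscherlich beta (triple x1 x2 x3 i))).
Proof.
move=> b3 x1ge x2gt x3gt; pose x := triple x1 x2 x3.
rewrite contrast_formE//.
pose V : 'M[R]_3 := \matrix_(i, r)
  triple 1 (x i `^ beta3) (beta2 * powR_ln beta3 (x i)) r.
rewrite (_ : fisher_info _ _ _ _ = \matrix_(r, s) \sum_i
   ((n i)%:R * derive1 g (mitscherlich beta (x i))) * V i r * V i s); last first.
  apply/matrixP => r s; rewrite !mxE; apply: eq_bigr => i _.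
  by rewrite !mxE !mean_partialE.
rewrite det_gram_weighted det_rows_1ab /contrast_form /x /triple /=.
by congr (_ * _); ring.
Qed.

(** * Existence of an interior maximizer *)

Lemma interior_maximizer {R : realType} (f : R -> R) (a b : R) :
  a < b -> {within `[a, b], continuous f} ->
  (forall x, a < x < b -> f a <= f x /\ f b <= f x) ->
  exists x, maximizer_on `]a, b[ f x.
Proof.
move=> ab cf fab; have [c] := EVT_max (ltW ab) cf.
rewrite in_itv /= => /andP[ac cb] fc.
have [|cN] := boolP (a < c < b).
  move=> acb; exists c; split; first by rewrite /= in_itv.
  move=> y /=; rewrite in_itv /= => /andP[ay yb].
  by apply: fc; rewrite in_itv /= !ltW.
(* The maximum sits at an endpoint, so no interior value exceeds any other;
   the midpoint is as good a maximizer as any. *)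
have m : a < (a + b) / 2 < b by rewrite midf_lt// midf_lt.
exists ((a + b) / 2); split; first by rewrite /= in_itv.
move=> y /=; rewrite in_itv /= => /andP[ay yb].
have [fa fb] := fab _ m.
have : f y <= f c by apply: fc; rewrite in_itv /= !ltW.
move/le_trans; apply; move: cN; rewrite negb_and -!leNgt => /orP[ca|bc].
  by rewrite (@le_anti _ _ c a) ?ac ?ca.
by rewrite (@le_anti _ _ c b) ?bc ?cb.
Qed.

(** * The first-order condition *)

(** The derivative of the contrast in x2 is x2^(p-1) times this bracket. *)
Definition contrast_slope {R : realType} (p x1 x2 x3 : R) : R :=
  p * x1 `^ p * ln (x2 / x1) + p * x3 `^ p * ln (x3 / x2) + x1 `^ p - x3 `^ p.

(** In this form the bracket is visibly affine in ln x2 with a negative slope when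
    x1 < x3, so that its nonnegativity bounds x2 from above. *)
Lemma contrast_slopeE {R : realType} (p x1 x2 x3 : R) :
  0 < p -> 0 <= x1 -> 0 < x2 -> 0 < x3 ->
  contrast_slope p x1 x2 x3 =
  x3 `^ p * ln (x3 `^ p) - x1 `^ p * ln (x1 `^ p) - (x3 `^ p - x1 `^ p)
  - p * ln x2 * (x3 `^ p - x1 `^ p).
Proof.
move=> p0 x1ge x2gt x3gt.
rewrite /contrast_slope !ln_powR (ln_div x3gt x2gt).
have [->|x1N] := eqVneq x1 0; first by rewrite powR0 ?gt_eqF//; ring.
have x1gt : 0 < x1 by rewrite lt_neqAle eq_sym x1N.
by rewrite ln_div ?posrE//; ring.
Qed.

Lemma is_derive_contrast_form {R : realType} (p x1 x2 x3 : R) :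
  0 < p -> 0 <= x1 -> 0 < x2 -> 0 < x3 ->
  is_derive x2 1 (fun x => contrast_form p x1 x x3)
    (x2 `^ (p - 1) * contrast_slope p x1 x2 x3).
Proof.
move=> p0 x1ge x2gt x3gt.
have dq := is_derive1_powR p x2gt; have dl := is_derive_powR_ln p x2 x2gt.
rewrite /contrast_form; apply: is_derive_eq.
rewrite contrast_slopeE// /GRing.scale /= /powR_ln !ln_powR.
ring.
Qed.

Lemma contrast_form_cvg_right {R : realType} (p x1 x3 : R) :
  0 < p -> 0 <= x1 ->
  contrast_form p x1 x x3 @[x --> x1^'+] --> contrast_form p x1 x1 x3.
Proof.
move=> p0 x1ge.
have cq := powR_cvg_right _ _ p0 x1ge; have cl := powR_ln_cvg_right _ _ p0 x1ge.
apply: cvgD; first apply: cvgD; apply: cvgM => //; try exact: cvg_cst.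
- by apply: cvgB => //; exact: cvg_cst.
- by apply: cvgB => //; exact: cvg_cst.
Qed.

Lemma is_derive_mitscherlich {R : realType} (beta1 beta2 beta3 x : R) :
  0 < x ->
  is_derive x 1 (mitscherlich (params beta1 beta2 beta3))
    (beta2 * (beta3 * x `^ (beta3 - 1))).
Proof.
move=> x0; have dq := is_derive1_powR beta3 x0.
rewrite (_ : mitscherlich _ = fun y => beta1 + beta2 * y `^ beta3); last first.
  by apply/funext => y; rewrite /mitscherlich /params !mxE.
by apply: is_derive_eq; rewrite /GRing.scale /=; ring.
Qed.

Lemma mitscherlich_cvg_right {R : realType} (beta1 beta2 beta3 a : R)
    (mu := mitscherlich (params beta1 beta2 beta3)) :
  0 < beta3 -> 0 <= a -> mu x @[x --> a^'+] --> mu a.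
Proof.
move=> b3 a0; rewrite /mu /mitscherlich /params !mxE.
apply: cvgD; first exact: cvg_cst.
by apply: cvgM; [exact: cvg_cst|exact: powR_cvg_right].
Qed.

(** The factor of the determinant that depends on the middle stimulus. *)
Definition information_profile {R : realType} (g : R -> R)
    (beta1 beta2 beta3 x1 x3 x : R) : R :=
  contrast_form beta3 x1 x x3 ^+ 2
  * derive1 g (mitscherlich (params beta1 beta2 beta3) x).

(** mu' x2 = beta2 p x2^(p-1) and the derivative of the contrast share the factor
    x2^(p-1), and the square of the contrast leaves another factor C. The
    remaining factor is the left-hand side of the optimality equation. *)
Lemma is_derive_information_profile {R : realType} (g : R -> R)
    (beta1 beta2 beta3 x1 x2 x3 : R)
    (mu := mitscherlich (params beta1 beta2 beta3)) :
  0 < beta3 -> 0 <= x1 -> 0 < x2 -> 0 < x3 ->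
  derivable (derive1 g) (mu x2) 1 ->
  is_derive x2 1 (information_profile g beta1 beta2 beta3 x1 x3)
    (x2 `^ (beta3 - 1) * contrast_form beta3 x1 x2 x3
     * (beta2 * beta3 * derive1n 2 g (mu x2) * contrast_form beta3 x1 x2 x3
        + 2 * derive1 g (mu x2) * contrast_slope beta3 x1 x2 x3)).
Proof.
move=> b3 x1ge x2gt x3gt dg.
have dC := is_derive_contrast_form beta3 x1 x2 x3 b3 x1ge x2gt x3gt.
have dG := is_derive1_comp (derivableP dg)
  (is_derive_mitscherlich beta1 beta2 beta3 x2 x2gt).
have dF := is_deriveM (is_deriveX 2 dC) dG.
apply: (is_derive_eq dF).
rewrite /derive1n /= -derive1E /GRing.scale /= -/mu.
rewrite (_ : (_ ^+ 2) x2 = contrast_form beta3 x1 x2 x3 ^+ 2)//.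
ring.
Qed.

(** * The optimal middle stimulus *)

Theorem theorem3 (R : realType) (L U beta1 beta2 beta3 : R) (n : 'I_3 -> nat)
    (b g : R -> R) (Theta J : set R) (x1 x3 : R)
    (mu := mitscherlich (params beta1 beta2 beta3))
    (detI := fun x2 : R =>
       \det (fisher_info g n (params beta1 beta2 beta3) (triple x1 x2 x3))) :
  0 <= L -> L < U ->
  0 <= beta1 -> 0 < beta2 -> 0 < beta3 ->
  (forall i, (0 < n i)%N) ->
  canonical_link b Theta g J ->
  (forall x, L <= x <= U -> J (mu x)) ->
  (forall x, L <= x <= U -> 0 <= derive1 g (mu x)) ->
  (forall x, L <= x <= U -> derive1n 2 g (mu x) <= 0) ->
  L <= x1 -> x1 < x3 -> x3 <= U ->
  [/\ (forall x2, x1 < x2 < x3 ->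
         detI x2 = beta2 ^+ 2 * contrast beta3 x1 x2 x3 ^+ 2
                   * \prod_(i < 3) ((n i)%:R * derive1 g (mu (triple x1 x2 x3 i)))),
      (exists x2, maximizer_on `]x1, x3[ detI x2)
    & (forall x2, maximizer_on `]x1, x3[ detI x2 ->
         [/\ beta2 * beta3 * derive1n 2 g (mu x2) * contrast beta3 x1 x2 x3
             + 2 * derive1 g (mu x2)
               * (beta3 * x1 `^ beta3 * ln (x2 / x1)
                  + beta3 * x3 `^ beta3 * ln (x3 / x2)
                  + x1 `^ beta3 - x3 `^ beta3) = 0,
             x1 < x2 < x3
           & beta3 * ln x2 <=
             (x3 `^ beta3 * ln (x3 `^ beta3) - x1 `^ beta3 * ln (x1 `^ beta3)
              - (x3 `^ beta3 - x1 `^ beta3))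
             / (x3 `^ beta3 - x1 `^ beta3)])].
Proof.
move=> L0 LU _ b2 b3 n0 link Jmu g1ge g2le Lx1 x13 x3U.
have x1ge := le_trans L0 Lx1; have x3gt := le_lt_trans x1ge x13.
have inLU x : x1 <= x <= x3 -> L <= x <= U.
  by move=> /andP[h1 h2]; rewrite (le_trans Lx1 h1) (le_trans h2 x3U).
have x1in : L <= x1 <= U by apply: inLU; rewrite lexx ltW.
have x3in : L <= x3 <= U by apply: inLU; rewrite lexx ltW.
have g1gt x : L <= x <= U -> 0 < derive1 g (mu x).
  move=> xin; rewrite lt_def g1ge// andbT.
  exact: canonical_link_derive_neq0 link (Jmu _ xin).
have dg x : L <= x <= U -> derivable (derive1 g) (mu x) 1.
  by move=> /Jmu Jx; have [_ [_ _ /(_ _ Jx)[]]] := link.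
have detE x2 : x1 < x2 < x3 ->
    detI x2 = beta2 ^+ 2 * contrast beta3 x1 x2 x3 ^+ 2
      * \prod_(i < 3) ((n i)%:R * derive1 g (mu (triple x1 x2 x3 i))).
  by move=> /andP[x12 _]; apply: det_fisher_info => //; exact: le_lt_trans x12.
set F := information_profile g beta1 beta2 beta3 x1 x3.
pose K := beta2 ^+ 2 * (n 0)%:R * (n 1)%:R * (n 2%:R)%:R
  * derive1 g (mu x1) * derive1 g (mu x3).
have K0 : 0 < K by rewrite !mulr_gt0 ?exprn_gt0 ?ltr0n ?n0 ?g1gt.
have detF x2 : x1 < x2 < x3 -> detI x2 = K * F x2.
  move=> x2in; have /andP[x12 _] := x2in.
  rewrite detE// contrast_formE//; last exact: le_lt_trans x12.
  rewrite !big_ord_recl big_ord0 /triple /= /K /F /information_profile -/mu.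
  have -> : lift 0 (lift 0 0) = 2%:R :> 'I_3 by apply/val_inj.
  have -> : lift 0 0 = 1 :> 'I_3 by apply/val_inj.
  ring.
have dF x : x1 < x -> x <= x3 -> is_derive x 1 F _ := fun h1 h2 =>
  is_derive_information_profile g beta1 beta2 beta3 x1 x x3 b3 x1ge
    (le_lt_trans x1ge h1) x3gt (dg _ (inLU _ (introT andP (conj (ltW h1) h2)))).
have contF x : x1 < x -> x <= x3 -> {for x, continuous F}.
  move=> h1 h2; apply: differentiable_continuous; apply/derivable1_diffP.
  by have [] := dF x h1 h2.
have F_right : F x @[x --> x1^'+] --> F x1.
  apply: cvgM.
    by apply: cvgM; exact: contrast_form_cvg_right.
  apply: (continuous_cvg _ _ (mitscherlich_cvg_right _ _ _ _ b3 x1ge)).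
  by apply: differentiable_continuous; apply/derivable1_diffP; exact: dg.
have F_ge0 x : x1 < x < x3 -> 0 <= F x.
  move=> /andP[h1 h2].
  by rewrite mulr_ge0 ?sqr_ge0// g1ge// inLU// !ltW.
have Fx1 : F x1 = 0 by rewrite /F /information_profile /contrast_form; ring.
have Fx3 : F x3 = 0 by rewrite /F /information_profile /contrast_form; ring.
(* Only the facts above about the determinant and [F] matter from here on. *)
clearbody detI F.
have maxF x2 : maximizer_on `]x1, x3[ detI x2 <-> maximizer_on `]x1, x3[ F x2.
  split=> -[x2in x2max]; (split; first exact: x2in) => y yin;
    have := x2max _ yin; move: x2in yin; rewrite /= !in_itv /= => x2in yin;
    by rewrite !detF// ler_pM2l.
split=> //.
  suff [x Fx] : exists x, maximizer_on `]x1, x3[ F x by exists x; exact/maxF.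
  apply: interior_maximizer => //.
    apply/continuous_within_itvP => //; split.
    - move=> x; rewrite in_itv /= => /andP[h1 h2].
      by apply: contF => //; exact: ltW.
    - exact: F_right.
    - by apply: cvg_at_left_filter; exact: contF.
  by move=> x xin; rewrite Fx1 Fx3 F_ge0.
move=> x2 /maxF[]; rewrite /= in_itv /= => x2in x2max.
have /andP[x12 x23] := x2in; have x2gt := le_lt_trans x1ge x12.
have C0 := contrast_gt0 beta3 x1 x2 x3 b3 x1ge x12 x23.
have x2LU : L <= x2 <= U by apply: inLU; rewrite !ltW.
have foc : beta2 * beta3 * derive1n 2 g (mu x2) * contrast beta3 x1 x2 x3
    + 2 * derive1 g (mu x2) * contrast_slope beta3 x1 x2 x3 = 0.
  have [_ dF0] : is_derive x2 1 F 0.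
    apply: (@derive1_at_max _ F x1 x3) => //; first exact: ltW.
    move=> t; rewrite in_itv /= => /andP[h1 h2].
    by have [] := dF t h1 (ltW h2).
  have [_] := dF x2 x12 (ltW x23); rewrite dF0 -contrast_formE// => /esym/eqP.
  by rewrite mulf_eq0 gt_eqF /= => [/eqP|]; rewrite ?mulr_gt0 ?powR_gt0.
split=> //.
have a_lt_c : 0 < x3 `^ beta3 - x1 `^ beta3.
  by rewrite subr_gt0 gt0_ltr_powR ?nnegrE// ltW.
rewrite ler_pdivlMr// -subr_ge0 -contrast_slopeE//.
have g2C : beta2 * beta3 * derive1n 2 g (mu x2) * contrast beta3 x1 x2 x3 <= 0.
  by rewrite pmulr_lle0// pmulr_rle0 ?mulr_gt0// g2le.
rewrite -(pmulr_rge0 _ (_ : 0 < 2 * derive1 g (mu x2))) ?mulr_gt0 ?g1gt//.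
by move: foc => /eqP; rewrite addrC addr_eq0 => /eqP ->; rewrite oppr_ge0.
Qed.
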